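(* Let $n\ge 1$ and $m\ge 3$ be integers, and let $H_1,\ldots,H_m\in M_n(\mathbb{C})$ satisfy $H_j=H_j^*$ and $\|H_j\|\le 1$ for $j=1,\ldots,m$. Let $\delta\ge 0$ be a real number such that $\|[H_i,H_j]\|_{\mathrm{tr}}\le\delta$ for all $i,j=1,\ldots,m$, and suppose that $$\delta\le \frac{1}{16^{\,2\cdot 4^{m-2}}}.$$ Then there exist $A_1,\ldots,A_m\in M_n(\mathbb{C})$ such that $$\|A_j\|\le 1,\quad A_j=A_j^*,\quad \|H_j-A_j\|_{\mathrm{tr}}\le 5\,\delta^{1/4^{m-1}},\qquad j=1,\ldots,m,$$ and $[A_i,A_j]=0$ for all $i,j=1,\ldots,m$. In addition, $A_1,\ldots,A_m$ can be chosen so that also $[H_1,A_1]=0$.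
   Context: $M_n(\mathbb{C})$ is the algebra of complex $n\times n$ matrices, $A^*$ is the conjugate transpose, $[A,B]=AB-BA$, and $\|A\|$ is the operator norm of $A$ acting on $\mathbb{C}^n$ with its standard Hermitian inner product. The normalized Hilbert-Schmidt norm of $A=\{a_{ij}\}_{i,j=1}^n\in M_n(\mathbb{C})$ is defined by $\|A\|_{\mathrm{tr}}^2=\frac1n\sum_{i,j=1}^n|a_{ij}|^2$. The exponent $1/4^{m-1}$ means $4^{-(m-1)}$, and the bound on $\delta$ is $16$ raised to the power $-2\cdot 4^{m-2}$. *)

(* Defs.v *)
From HB Require Import structures.
From mathcomp Require Import all_boot all_order all_algebra.
From mathcomp Require Import sesquilinear spectral.
From mathcomp Require Import all_classical all_reals all_analysis.
From mathcomp Require Import complex.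

Set Implicit Arguments.
Unset Strict Implicit.
Unset Printing Implicit Defensive.

Import Order.TTheory GRing.Theory Num.Theory.
Local Open Scope classical_set_scope.
Local Open Scope ring_scope.

Definition mxbracket (R : realType) (n : nat) (A B : 'M[R[i]]_n) : 'M[R[i]]_n :=
  A *m B - B *m A.

Definition l2norm (R : realType) (n : nat) (v : 'cV[R[i]]_n) : R :=
  Num.sqrt (\sum_(i < n) Normc.normc (v i 0) ^+ 2).

(* The set is nonempty and bounded above for every A, so [sup], which is 0 on
   sets without a supremum, is the genuine supremum here. *)
Definition opnorm (R : realType) (n : nat) (A : 'M[R[i]]_n) : R :=
  sup [set l2norm (A *m v) | v in [set v : 'cV[R[i]]_n | l2norm v <= 1]].

Definition trnorm (R : realType) (n : nat) (A : 'M[R[i]]_n) : R :=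
  Num.sqrt (n%:R^-1 * \sum_(i < n) \sum_(j < n) Normc.normc (A i j) ^+ 2).

(* Main.v *)
Require Import Defs.
From HB Require Import structures.
From mathcomp Require Import all_boot all_order all_algebra.
From mathcomp Require Import sesquilinear spectral.
From mathcomp Require Import all_classical all_reals all_analysis.
From mathcomp Require Import complex.
From mathcomp Require Import ring lra zify.

Set Implicit Arguments.
Unset Strict Implicit.
Unset Printing Implicit Defensive.

Import Order.TTheory GRing.Theory Num.Theory.
Local Open Scope ring_scope.
Local Open Scope sesquilinear_scope.

(* Work in an eigenbasis of H_1 and cut [-1, 1] into cells of length eps, the
   offset of the cells being chosen by averaging. Replacing each eigenvalue by a
   point of its cell gives A_1, and deleting from H_j (j > 1) the entries that
   join different cells gives B_j, which commutes with A_1. An entry between the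
   eigenvalues x and y is deleted with probability at most |x - y| / eps, so by
   Cauchy-Schwarz ||H_j - B_j||^2 is on average at most ||[H_1, H_j]|| / eps in
   the trace norm. Then the B_j almost commute, and the argument is repeated on them.
   With t = delta^(1/4^(m-1)) one takes eps = 10 t, and the B_j satisfy the
   hypothesis of the next step with 9 t / 10 in place of t. When 5 t >= 1, the
   zero matrices already work. *)

(** * Cauchy-Schwarz and Minkowski for finite sums *)

(** Lagrange's identity: twice the difference of the two sides is the sum of the squares (x_i y_j -
    x_j y_i)^2 over all i and j. *)
Lemma sum_cauchy_schwarz (F : realDomainType) (I : finType) (x y : I -> F) :
  (\sum_i x i * y i) ^+ 2 <= (\sum_i x i ^+ 2) * (\sum_i y i ^+ 2).
Proof.
have : 0 <= \sum_i \sum_j (x i * y j - x j * y i) ^+ 2.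
  by apply: sumr_ge0 => i _; apply: sumr_ge0 => j _; exact: sqr_ge0.
suff -> : \sum_i \sum_j (x i * y j - x j * y i) ^+ 2 =
    ((\sum_i x i ^+ 2) * (\sum_i y i ^+ 2) - (\sum_i x i * y i) ^+ 2) *+ 2.
  by rewrite pmulrn_lge0 // subr_ge0.
transitivity (\sum_i \sum_j x i ^+ 2 * y j ^+ 2 +
    \sum_i \sum_j y i ^+ 2 * x j ^+ 2 -
    (\sum_i \sum_j (x i * y i) * (x j * y j)) *+ 2); last first.
  by rewrite -!big_distrlr /= -expr2; ring.
rewrite -sumrMnl -big_split -sumrB; apply: eq_bigr => i _.
rewrite -sumrMnl -big_split -sumrB; apply: eq_bigr => j _ /=.
ring.
Qed.

Lemma sqrt_sum_sqrD (F : rcfType) (I : finType) (x y : I -> F) :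
  Num.sqrt (\sum_i (x i + y i) ^+ 2) <=
  Num.sqrt (\sum_i x i ^+ 2) + Num.sqrt (\sum_i y i ^+ 2).
Proof.
have s0 (z : I -> F) : 0 <= \sum_i z i ^+ 2.
  by apply: sumr_ge0 => i _; exact: sqr_ge0.
rewrite -(ler_pXn2r (ltn0Sn 1)) ?nnegrE ?addr_ge0 ?sqrtr_ge0 //.
rewrite sqrrD !sqr_sqrtr //.
under eq_bigr do rewrite sqrrD.
rewrite !big_split /= lerD2r lerD2l -mulr2n lerMn2r /=.
apply: le_trans (ler_norm _) _; rewrite -sqrtr_sqr -sqrtrM //.
by apply: ler_wsqrtr; exact: sum_cauchy_schwarz.
Qed.

(** * Hilbert-Schmidt sums and contractions *)

(** Squared, unnormalized and rectangular, so that it serves matrices and column vectors alike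
    without square roots. *)
Definition hs (R : realType) (m n : nat) (A : 'M[R[i]]_(m, n)) : R :=
  \sum_(i < m) \sum_(j < n) Normc.normc (A i j) ^+ 2.

(** A form of [opnorm A <= 1] free of suprema; the two are shown equivalent below. *)
Definition contraction (R : realType) (n : nat) (A : 'M[R[i]]_n) :=
  forall v : 'cV[R[i]]_n, hs (A *m v) <= hs v.

Lemma normc_ge0 (R : realType) (z : R[i]) : 0 <= Normc.normc z.
Proof. by rewrite -ler0c; exact: (normr_ge0 z). Qed.

Lemma normc_real (R : realType) (x : R) : Normc.normc (x%:C%C) = `|x|.
Proof. by rewrite /= expr0n addr0 sqrtr_sqr. Qed.

Lemma normc_conj (R : realType) (z : R[i]) : Normc.normc (z^*) = Normc.normc z.
Proof. by apply: (@complexI R); exact: (norm_conjC z). Qed.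

Lemma le_normc_sum (R : realType) (I : finType) (F : I -> R[i]) :
  Normc.normc (\sum_k F k) <= \sum_k Normc.normc (F k).
Proof.
elim/big_rec2: _ => [|k y x _ xy]; first by rewrite Normc.normc0.
by apply: le_trans (le_normcD _ _) _; rewrite lerD2l.
Qed.

Lemma hs_ge0 (R : realType) (m n : nat) (A : 'M[R[i]]_(m, n)) : 0 <= hs A.
Proof. by apply: sumr_ge0 => i _; apply: sumr_ge0 => j _; exact: sqr_ge0. Qed.

Lemma hs0 (R : realType) (m n : nat) : hs (0 : 'M[R[i]]_(m, n)) = 0.
Proof.
rewrite /hs big1 // => i _; rewrite big1 // => j _.
by rewrite mxE Normc.normc0 expr0n.
Qed.

Lemma hs_pair (R : realType) (m n : nat) (A : 'M[R[i]]_(m, n)) :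
  hs A = \sum_(p : 'I_m * 'I_n) Normc.normc (A p.1 p.2) ^+ 2.
Proof. by rewrite /hs pair_bigA. Qed.

(** Through the trace, invariance under adjoints and isometries becomes cyclicity. *)
Lemma hsE (R : realType) (m n : nat) (A : 'M[R[i]]_(m, n)) :
  ((hs A)%:C)%C = \tr (A *m A^t*).
Proof.
rewrite rmorph_sum /=; apply: eq_bigr => i _.
rewrite mxE rmorph_sum /=; apply: eq_bigr => j _.
by rewrite !mxE rmorphXn /= -normCK.
Qed.

Lemma adjmxM (R : realType) (m n p : nat) (A : 'M[R[i]]_(m, n))
  (B : 'M[R[i]]_(n, p)) : (A *m B)^t* = B^t* *m A^t*.
Proof. by rewrite trmx_mul map_mxM. Qed.

Lemma hs_adj (R : realType) (m n : nat) (A : 'M[R[i]]_(m, n)) : hs (A^t*) = hs A.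
Proof. by apply: (@complexI R); rewrite !hsE trmxCK mxtrace_mulC. Qed.

Lemma hsN (R : realType) (m n : nat) (A : 'M[R[i]]_(m, n)) : hs (- A) = hs A.
Proof.
by apply: eq_bigr => i _; apply: eq_bigr => j _; rewrite mxE normcN.
Qed.

Lemma hsZ (R : realType) (m n : nat) (c : R) (A : 'M[R[i]]_(m, n)) :
  hs ((c%:C)%C *: A) = c ^+ 2 * hs A.
Proof.
rewrite /hs mulr_sumr; apply: eq_bigr => i _.
rewrite mulr_sumr; apply: eq_bigr => j _.
by rewrite mxE Normc.normcM exprMn normc_real real_normK ?num_real.
Qed.

Lemma hs_eq0 (R : realType) (m n : nat) (A : 'M[R[i]]_(m, n)) : hs A = 0 -> A = 0.
Proof.
move=> A0; apply/matrixP => i j; rewrite mxE; apply: Normc.eq0_normc.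
have h k : 0 <= \sum_j Normc.normc (A k j) ^+ 2.
  by apply: sumr_ge0 => l _; exact: sqr_ge0.
move/eqP: A0; rewrite /hs psumr_eq0 // => /allP /(_ i (mem_index_enum _)).
rewrite /= psumr_eq0 => [/allP /(_ j (mem_index_enum _))|l _]; last exact: sqr_ge0.
by rewrite /= sqrf_eq0 => /eqP.
Qed.

Lemma hs_isometry (R : realType) (m n p : nat) (U : 'M[R[i]]_(p, m))
  (A : 'M[R[i]]_(m, n)) : U^t* *m U = 1%:M -> hs (U *m A) = hs A.
Proof.
move=> UU; apply: (@complexI R); rewrite !hsE adjmxM mulmxA mxtrace_mulC.
by rewrite !mulmxA UU mul1mx.
Qed.

Lemma sqrt_hsD (R : realType) (m n : nat) (A B : 'M[R[i]]_(m, n)) :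
  Num.sqrt (hs (A + B)) <= Num.sqrt (hs A) + Num.sqrt (hs B).
Proof.
rewrite !hs_pair; apply: le_trans (sqrt_sum_sqrD _ _).
apply: ler_wsqrtr; apply: ler_sum => p _.
by rewrite lerXn2r ?nnegrE ?addr_ge0 ?normc_ge0 // mxE le_normcD.
Qed.

Lemma hs_mulmx (R : realType) (m n p : nat) (A : 'M[R[i]]_(m, n))
  (B : 'M[R[i]]_(n, p)) : hs (A *m B) <= hs A * hs B.
Proof.
rewrite -[hs B]hs_adj /hs big_distrlr /=.
apply: ler_sum => i _; apply: ler_sum => j _; rewrite mxE.
apply: le_trans (_ : (\sum_k Normc.normc (A i k) * Normc.normc (B k j)) ^+ 2 <= _).
  rewrite lerXn2r ?nnegrE ?normc_ge0 ?sumr_ge0 // => [k _|].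
    by rewrite mulr_ge0 ?normc_ge0.
  apply: le_trans (le_normc_sum _) _.
  by apply: ler_sum => k _; rewrite Normc.normcM.
apply: le_trans (sum_cauchy_schwarz _ _) _.
rewrite ler_wpM2l ?sumr_ge0 // => [k _|]; first exact: sqr_ge0.
by apply: ler_sum => k _; rewrite !mxE normc_conj.
Qed.

Lemma hs_cV (R : realType) (n : nat) (v : 'cV[R[i]]_n) :
  hs v = \sum_i Normc.normc (v i 0) ^+ 2.
Proof. by apply: eq_bigr => i _; rewrite big_ord1. Qed.

(** A contraction acts on each column separately. *)
Lemma hs_contractionl (R : realType) (n p : nat) (A : 'M[R[i]]_n)
  (B : 'M[R[i]]_(n, p)) : contraction A -> hs (A *m B) <= hs B.
Proof.
move=> cA; rewrite /hs exchange_big [leRHS]exchange_big /=.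
apply: ler_sum => j _.
have e (M : 'M[R[i]]_(n, p)) : \sum_i Normc.normc (M i j) ^+ 2 = hs (col j M).
  by rewrite hs_cV; apply: eq_bigr => i _; rewrite mxE.
by rewrite !e colE -mulmxA -colE.
Qed.

Lemma hs_contractionr (R : realType) (n p : nat) (A : 'M[R[i]]_n)
  (B : 'M[R[i]]_(p, n)) : contraction (A^t*) -> hs (B *m A) <= hs B.
Proof.
by move=> cA; rewrite -hs_adj adjmxM -[leRHS]hs_adj; exact: hs_contractionl.
Qed.

(** * The norms of the statement in terms of [hs] *)

Lemma l2norm_hs (R : realType) (n : nat) (v : 'cV[R[i]]_n) :
  l2norm v = Num.sqrt (hs v).
Proof.
by rewrite hs_cV.
Qed.

Lemma trnorm_hs (R : realType) (n : nat) (A : 'M[R[i]]_n) :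
  trnorm A = Num.sqrt (n%:R^-1 * hs A).
Proof. by []. Qed.

Lemma trnorm_ge0 (R : realType) (n : nat) (A : 'M[R[i]]_n) : 0 <= trnorm A.
Proof. exact: sqrtr_ge0. Qed.

Lemma sqr_trnorm (R : realType) (n : nat) (A : 'M[R[i]]_n) :
  trnorm A ^+ 2 = n%:R^-1 * hs A.
Proof. by rewrite sqr_sqrtr // mulr_ge0 ?invr_ge0 ?hs_ge0. Qed.

Lemma le_trnorm (R : realType) (n : nat) (A B : 'M[R[i]]_n) :
  hs A <= hs B -> trnorm A <= trnorm B.
Proof. by move=> AB; rewrite ler_wsqrtr // ler_wpM2l ?invr_ge0. Qed.

Lemma trnorm_le (R : realType) (n : nat) (A : 'M[R[i]]_n) (c : R) :
  0 <= c -> trnorm A ^+ 2 <= c ^+ 2 -> trnorm A <= c.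
Proof. by move=> c0; rewrite ler_pXn2r ?nnegrE ?trnorm_ge0. Qed.

Lemma trnormN (R : realType) (n : nat) (A : 'M[R[i]]_n) : trnorm (- A) = trnorm A.
Proof. by rewrite !trnorm_hs hsN. Qed.

Lemma trnormD (R : realType) (n : nat) (A B : 'M[R[i]]_n) :
  trnorm (A + B) <= trnorm A + trnorm B.
Proof.
by rewrite !trnorm_hs !sqrtrM ?invr_ge0 // -mulrDr ler_wpM2l ?sqrtr_ge0 ?sqrt_hsD.
Qed.

Lemma contraction_opnorm (R : realType) (n : nat) (A : 'M[R[i]]_n) :
  contraction A -> opnorm A <= 1.
Proof.
move=> cA; apply: ge_sup => [|_ [v /= v1 <-]].
  exists (l2norm (A *m 0)), 0 => //=.
  by rewrite l2norm_hs hs0 sqrtr0 ler01.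
by apply: le_trans v1; rewrite !l2norm_hs ler_wsqrtr.
Qed.

(** Rescaling [v] to norm 1 puts it in the set whose supremum is [opnorm A]; [hs_mulmx] shows that
    this set is bounded. *)
Lemma opnorm_contraction (R : realType) (n : nat) (A : 'M[R[i]]_n) :
  opnorm A <= 1 -> contraction A.
Proof.
move=> A1 v; have [v0|v0] := eqVneq (hs v) 0.
  by rewrite (hs_eq0 v0) mulmx0 hs0.
have hv : 0 < hs v by rewrite lt_def v0 hs_ge0.
pose c := (Num.sqrt (hs v))^-1.
have c2 : c ^+ 2 = (hs v)^-1 by rewrite exprVn sqr_sqrtr ?hs_ge0.
have : l2norm (A *m ((c%:C)%C *: v)) <= opnorm A.
  apply: ub_le_sup; last first.
    exists ((c%:C)%C *: v) => //=.
    by rewrite l2norm_hs hsZ c2 mulVf // sqrtr1.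
  exists (Num.sqrt (hs A)) => _ [w /= w1 <-]; rewrite !l2norm_hs in w1 *.
  apply: ler_wsqrtr; apply: le_trans (hs_mulmx _ _) _.
  rewrite ler_piMr ?hs_ge0 // -[leLHS]sqr_sqrtr ?hs_ge0 //.
  by rewrite exprn_ile1 ?sqrtr_ge0.
move=> /le_trans /(_ A1); rewrite l2norm_hs -scalemxAr hsZ c2 -sqrtr1.
rewrite ler_sqrt ?ler01 // mulrC ler_pdivrMr // mul1r; exact.
Qed.

(** The identity has [hs] equal to n, which the normalization turns into 1. *)
Lemma trnorm_contraction (R : realType) (n : nat) (A : 'M[R[i]]_n) :
  (0 < n)%N -> contraction A -> trnorm A <= 1.
Proof.
move=> n0 cA; apply: trnorm_le => //; rewrite sqr_trnorm expr1n.
rewrite -ler_pdivlMl ?invr_gt0 ?ltr0n // invrK mulr1 -[A]mulmx1; apply: le_trans (hs_contractionl _ cA) _.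
by rewrite -lecR hsE mul1mx trmx1 map_mx1 mxtrace1 rmorph_nat.
Qed.

(** * Cells with a random offset *)

(** Hermite's identity. Passing from a to a + 1 drops the term a %/ M and gains (a + M) %/ M, which
    is one more. *)
Lemma sum_shifted_divn (M a : nat) :
  (0 < M)%N -> (\sum_(s < M) (a + s) %/ M)%N = a.
Proof.
move=> M0; elim: a => [|a IHa].
  by rewrite big1 // => s _; rewrite add0n divn_small.
case: M M0 IHa => // M _ IHa.
rewrite big_ord_recr /= addSnnS divnDr ?dvdnn // divnn /= addn1.
rewrite -[in RHS]IHa big_ord_recl /= addn0 addnS addnC; congr _.+1; congr addn.
by apply: eq_bigr => s _; rewrite addSnnS.
Qed.

(** For a <= b each separating shift adds at least 1 to the difference of the two Hermite sums,
    which is b - a. With truncated subtraction the bound is the distance |a - b|. *)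
Lemma separating_shifts (M a b : nat) : (0 < M)%N ->
  (\sum_(s < M) ((a + s) %/ M != (b + s) %/ M) <= (a - b) + (b - a))%N.
Proof.
move=> M0; wlog ab : a b / (a <= b)%N => [hw|].
  have [/hw //|/ltnW /hw] := leqP a b.
  by rewrite addnC; under eq_bigr do rewrite eq_sym.
have -> : (a - b = 0)%N by apply/eqP; rewrite subn_eq0.
rewrite add0n leq_subRL // -[X in (X + _ <= _)%N](sum_shifted_divn _ M0).
rewrite -[leqRHS](sum_shifted_divn _ M0) -big_split /=.
apply: leq_sum => s _.
have : ((a + s) %/ M <= (b + s) %/ M)%N by rewrite leq_div2r ?leq_add2r.
by case: eqVneq => [->|ne le]; rewrite ?addn0 // addn1 ltn_neqAle ne.
Qed.

Lemma exists_le_mean (F : realDomainType) (M : nat) (f : 'I_M -> F) (r : F) :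
  (0 < M)%N -> \sum_s f s <= M%:R * r -> exists s, f s <= r.
Proof.
move=> M0 fr; apply/existsP; apply: contraLR fr => /existsPn nf.
rewrite -ltNge mulr_natl -[X in _ *+ X]card_ord -sumr_const.
apply: ltr_sum => [|s _]; last by rewrite ltNge.
by apply/hasP; exists (Ordinal M0); rewrite ?mem_index_enum.
Qed.

(* The line is cut into cells of length eps with random offset: lam a is first
   rounded down to the integer [N a] in units of eps / M, and the offset s < M
   gives the cell number (N a + s) %/ M. *)
Lemma exists_cells (R : realType) (n M : nat) (lam : 'I_n -> R) (eps : R)
    (w : 'I_n -> 'I_n -> R) :
  (0 < M)%N -> 0 < eps -> (forall a, -1 <= lam a) -> (forall a b, 0 <= w a b) ->
  exists (lab : 'I_n -> nat) (c : nat -> R),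
    [/\ forall a b, lam a = lam b -> lab a = lab b,
        forall a, `|lam a - c (lab a)| <= eps / 2 &
        \sum_a \sum_b w a b *+ (lab a != lab b) <=
        \sum_a \sum_b w a b * (`|lam a - lam b| / eps + M%:R^-1)].
Proof.
move=> M0 e0 lam1 w0.
have M0r : 0 < M%:R :> R by rewrite ltr0n.
have Me0 : 0 < M%:R / eps by rewrite divr_gt0.
(* Shifting by 1 makes [x a] nonnegative, so that truncation is rounding down; one unit of [x] is
   eps / M. *)
pose x a := (lam a + 1) * (M%:R / eps).
have x0 a : 0 <= x a by rewrite mulr_ge0 ?(ltW Me0) // -lerBlDr sub0r.
pose N a := Num.truncn (x a).
have Nx a : (N a)%:R <= x a < (N a).+1%:R by exact: truncn_itv.
have [s hs] : exists s : 'I_M,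
   \sum_a \sum_b w a b *+ ((N a + s) %/ M != (N b + s) %/ M)%N <=
        \sum_a \sum_b w a b * (`|lam a - lam b| / eps + M%:R^-1).
  apply: exists_le_mean => //.
  rewrite exchange_big mulr_sumr; apply: ler_sum => a _ /=.
  rewrite exchange_big mulr_sumr; apply: ler_sum => b _ /=.
  rewrite sumrMnr mulrCA -[w a b *+ _]mulr_natr ler_wpM2l // mulrDr mulfV ?lt0r_neq0 //.
  (* The floors differ by less than |x a - x b| + 1; after division by M the extra 1 is the term 1 /
     M of the bound. *)
  apply: le_trans (_ : ((N a - N b) + (N b - N a))%:R <= _).
    by rewrite ler_nat separating_shifts.
  have -> : M%:R * (`|lam a - lam b| / eps) = `|x a - x b|.
    rewrite /x -mulrBl normrM (gtr0_norm Me0) opprD addrACA subrr addr0.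
    by rewrite mulrCA.
  have /andP[a1 a2] := Nx a; have /andP[b1 b2] := Nx b.
  rewrite -natr1 in a2; rewrite -natr1 in b2.
  have [ab|/ltnW ab] := leqP (N a) (N b).
    rewrite (eqP ab) add0n natrB // distrC.
    have := ler_norm (x b - x a); lra.
  rewrite (eqP ab) addn0 natrB //.
  have := ler_norm (x a - x b); lra.
exists (fun a => (N a + s) %/ M)%N.
(* Cell l holds the x between l M - s and l M - s + M; the witness is its midpoint, carried back to
   the scale of [lam]. *)
exists (fun l => (l%:R * M%:R - s%:R + M%:R / 2) * (eps / M%:R) - 1); split=> //.
  by move=> a b ab; rewrite /N /x ab.
move=> a; have /andP[a1 a2] := Nx a; rewrite -natr1 in a2.
set l := (_ %/ _)%N.
have -> : lam a = x a * (eps / M%:R) - 1.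
  by rewrite /x; field; rewrite !lt0r_neq0.
rewrite opprB addrA subrK -mulrBl normrM (gtr0_norm (divr_gt0 e0 M0r)).
have -> : eps / 2 = (M%:R / 2) * (eps / M%:R) by field; rewrite lt0r_neq0.
rewrite ler_pM2r ?divr_gt0 //.
have e : (N a)%:R + s%:R = l%:R * M%:R + ((N a + s) %% M)%:R :> R.
  by rewrite -natrM -!natrD -divn_eq.
have r0 : 0 <= ((N a + s) %% M)%:R :> R by [].
(* A remainder is at most M - 1, which leaves room for the fractional part of [x a]. *)
have r1 : ((N a + s) %% M)%:R + 1 <= M%:R :> R by rewrite natr1 ler_nat ltn_pmod.
by rewrite ler_norml; apply/andP; split; lra.
Qed.

(** * Pinching to the blocks of a labelling *)

(** The conditional expectation onto the matrices that are block diagonal for the level sets of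
    [lab]; [pinch lab Z = Z] says that Z is one of them. *)
Definition pinch (R : realType) (n : nat) (lab : 'I_n -> nat) (X : 'M[R[i]]_n) :
  'M[R[i]]_n := \matrix_(a, b) (X a b *+ (lab a == lab b)).

Lemma pinch_adj (R : realType) (n : nat) (lab : 'I_n -> nat) (X : 'M[R[i]]_n) :
  (pinch lab X)^t* = pinch lab (X^t*).
Proof. by apply/matrixP => a b; rewrite !mxE eq_sym rmorphMn. Qed.

Lemma pinch_mull (R : realType) (n : nat) (lab : 'I_n -> nat)
  (X Z : 'M[R[i]]_n) : pinch lab Z = Z -> pinch lab (Z *m X) = Z *m pinch lab X.
Proof.
move=> hZ; apply/matrixP => a c; rewrite !mxE -sumrMnl.
apply: eq_bigr => b _; rewrite -{}hZ !mxE.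
by have [->|] := eqVneq (lab a) (lab b); rewrite ?mulr0n ?mul0r ?mul0rn // mulrnAr.
Qed.

Lemma pinch_mulr (R : realType) (n : nat) (lab : 'I_n -> nat)
  (X Z : 'M[R[i]]_n) : pinch lab Z = Z -> pinch lab (X *m Z) = pinch lab X *m Z.
Proof.
move=> hZ; apply/matrixP => a c; rewrite !mxE -sumrMnl.
apply: eq_bigr => b _; rewrite -{}hZ !mxE.
by have [->|] := eqVneq (lab b) (lab c); rewrite ?mulr0n ?mulr0 ?mul0rn // mulrnAl.
Qed.

Lemma pinch_id (R : realType) (n : nat) (lab : 'I_n -> nat) (X : 'M[R[i]]_n) :
  pinch lab (pinch lab X) = pinch lab X.
Proof. by apply/matrixP => a b; rewrite !mxE; case: eqP; rewrite ?mulr0n. Qed.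

Lemma hs_pinch_compl (R : realType) (n : nat) (lab : 'I_n -> nat)
  (X : 'M[R[i]]_n) : hs (X - pinch lab X) =
  \sum_a \sum_b Normc.normc (X a b) ^+ 2 *+ (lab a != lab b).
Proof.
apply: eq_bigr => a _; apply: eq_bigr => b _; rewrite !mxE.
by case: eqP => _ /=; rewrite ?mulr0n ?mulr1n ?subr0 ?subrr // Normc.normc0 expr0n.
Qed.

(** Split v into its parts u_s by label. Row a of the pinched product sees only u_(lab a), so its
    squared norm is at most the sum of all |X u_s|^2, and the u_s are orthogonal. *)
Lemma contraction_pinch (R : realType) (n : nat) (lab : 'I_n -> nat)
  (X : 'M[R[i]]_n) : contraction X -> contraction (pinch lab X).
Proof.
move=> cX v; pose L := (\max_a lab a).+1.
have labL a : (lab a < L)%N by rewrite ltnS (leq_bigmax a).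
pose u (s : nat) : 'cV[R[i]]_n := \col_b (v b 0 *+ (lab b == s)).
have -> : hs v = \sum_(s < L) hs (u s).
  under [RHS]eq_bigr do rewrite hs_cV.
  rewrite hs_cV exchange_big /=; apply: eq_bigr => b _.
  rewrite (bigD1 (Ordinal (labL b))) //= big1 ?addr0 => [|s sb].
    by rewrite mxE eqxx.
  rewrite mxE; case: eqP => [e|_]; last by rewrite mulr0n Normc.normc0 expr0n.
  by move/eqP: sb; case; apply/val_inj.
apply: le_trans (_ : \sum_(s < L) hs (X *m u s) <= _); last exact: ler_sum.
under [leRHS]eq_bigr do rewrite hs_cV.
rewrite hs_cV [leRHS]exchange_big /=; apply: ler_sum => a _.
rewrite (bigD1 (Ordinal (labL a))) //=.
have -> : (pinch lab X *m v) a 0 = (X *m u (lab a)) a 0.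
  rewrite !mxE; apply: eq_bigr => b _.
  by rewrite !mxE mulrnAl mulrnAr eq_sym.
by rewrite lerDl sumr_ge0 // => s _; exact: sqr_ge0.
Qed.

(** * Real diagonal matrices *)

Definition rdiag (R : realType) (n : nat) (f : 'I_n -> R) : 'M[R[i]]_n :=
  diag_mx (\row_a ((f a)%:C)%C).

Lemma rdiag_mull (R : realType) (n : nat) (f : 'I_n -> R) (p : nat)
  (X : 'M[R[i]]_(n, p)) a b : (rdiag f *m X) a b = ((f a)%:C)%C * X a b.
Proof. by rewrite mul_diag_mx !mxE. Qed.

Lemma rdiag_mulr (R : realType) (n : nat) (f : 'I_n -> R) (p : nat)
  (X : 'M[R[i]]_(p, n)) a b : (X *m rdiag f) a b = X a b * ((f b)%:C)%C.
Proof. by rewrite mul_mx_diag !mxE. Qed.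

Lemma rdiag_adj (R : realType) (n : nat) (f : 'I_n -> R) : (rdiag f)^t* = rdiag f.
Proof.
apply/matrixP => a b; rewrite !mxE eq_sym.
case: eqP => [->|_]; rewrite ?mulr0n ?rmorph0 // !mulr1n.
exact: conjc_real.
Qed.

Lemma contraction_rdiag (R : realType) (n : nat) (f : 'I_n -> R) :
  (forall a, `|f a| <= 1) -> contraction (rdiag f).
Proof.
move=> f1 v; rewrite !hs_cV; apply: ler_sum => a _.
rewrite rdiag_mull Normc.normcM normc_real exprMn ler_piMl ?sqr_ge0 //.
by rewrite exprn_ile1.
Qed.

Lemma rdiag_contraction (R : realType) (n : nat) (f : 'I_n -> R) :
  contraction (rdiag f) -> forall a, `|f a| <= 1.
Proof.
move=> cf a; have h : hs (delta_mx a 0 : 'cV[R[i]]_n) = 1.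
  rewrite hs_cV (bigD1 a) //= big1 ?addr0 => [|b ba].
    by rewrite mxE !eqxx Normc.normc1 expr1n.
  by rewrite mxE (negPf ba) Normc.normc0 expr0n.
have := cf (delta_mx a 0); rewrite h hs_cV.
under eq_bigr do rewrite rdiag_mull Normc.normcM normc_real.
rewrite (bigD1 a) //= mxE !eqxx Normc.normc1 mulr1 => H.
rewrite -(ler_pXn2r (ltn0Sn 1)) ?nnegrE // expr1n; apply: le_trans H.
by rewrite lerDl sumr_ge0 // => s _; exact: sqr_ge0.
Qed.

Lemma hs_rdiag (R : realType) (n : nat) (f g : 'I_n -> R) (e : R) :
  (forall a, `|f a - g a| <= e) -> n%:R^-1 * hs (rdiag f - rdiag g) <= e ^+ 2.
Proof.
move=> fg; have [n0|n0] := posnP n.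
  rewrite /hs big1 ?mulr0 ?sqr_ge0 // => a _.
  by have := leq_trans (ltn_ord a) (eq_leq n0).
rewrite ler_pdivrMl ?ltr0n // mulr_natl -[X in _ *+ X]card_ord -sumr_const.
apply: ler_sum => a _; rewrite (bigD1 a) //= big1 ?addr0 => [|b ba].
  rewrite !mxE eqxx !mulr1n -rmorphB normc_real.
  by rewrite lerXn2r ?nnegrE //; apply: le_trans (fg a).
by rewrite !mxE eq_sym (negPf ba) !mulr0n subr0 Normc.normc0 expr0n.
Qed.

(** Commutation forces (f a - f b) X a b = 0, so X only joins indices with equal f, hence with equal
    labels. *)
Lemma rdiag_comm_pinch (R : realType) (n : nat) (f : 'I_n -> R)
  (lab : 'I_n -> nat) (X : 'M[R[i]]_n) :
  (forall a b, f a = f b -> lab a = lab b) -> X *m rdiag f = rdiag f *m X ->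
  pinch lab X = X.
Proof.
move=> fl Xf; apply/matrixP => a b; rewrite mxE; case: eqP => // /eqP nl.
apply/esym/eqP; rewrite mulr0n; have /matrixP /(_ a b) /eqP := Xf.
rewrite rdiag_mull rdiag_mulr mulrC -subr_eq0 -mulrBl mulf_eq0 => /orP[|//].
by rewrite subr_eq0 => /eqP /(@complexI R) /esym /fl /eqP; rewrite (negPf nl).
Qed.

(** On each block the diagonal matrix is a scalar. *)
Lemma pinch_comm_rdiag (R : realType) (n : nat) (f : nat -> R)
  (lab : 'I_n -> nat) (X : 'M[R[i]]_n) : pinch lab X = X ->
  X *m rdiag (f \o lab) = rdiag (f \o lab) *m X.
Proof.
move=> <-; apply/matrixP => a b; rewrite rdiag_mull rdiag_mulr !mxE /=.
by case: eqP => [->|_]; rewrite ?mulr0n ?mulr0 ?mul0r // mulrC.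
Qed.

(** * One approximation step in an eigenbasis *)

(** A cell centre may lie outside [-1, 1]. Clipping it makes A_1 a contraction and takes it no
    farther from any eigenvalue. *)
Lemma max_min_dist (R : realDomainType) (x y : R) :
  `|x| <= 1 -> `|x - Num.max (-1) (Num.min 1 y)| <= `|x - y|.
Proof.
rewrite ler_norml => /andP[x1 x2].
have [y1|y1] := leP 1 y; have [y2|y2] := leP (-1) _ => //.
- rewrite !ler0_norm; lra.
- lra.
- rewrite !ger0_norm; lra.
Qed.

Lemma norm_max_min (R : realDomainType) (y : R) :
  `|Num.max (-1) (Num.min 1 y)| <= 1.
Proof.
by rewrite ler_norml le_max lexx /= ge_max ge_min lexx /= andbT; lra.
Qed.

(* Cauchy-Schwarz for the entries |y| and |y| |lam a - lam b|; the latter are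
   the moduli of the entries of the commutator. *)
Lemma weighted_dist_le (R : realType) (n : nat) (lam : 'I_n -> R)
    (Y : 'M[R[i]]_n) (delta : R) :
  trnorm Y <= 1 -> trnorm (mxbracket (rdiag lam) Y) <= delta ->
  n%:R^-1 * \sum_a \sum_b Normc.normc (Y a b) ^+ 2 * `|lam a - lam b| <= delta.
Proof.
move=> Y1 Yd; have d0 : 0 <= delta by apply: le_trans Yd; exact: trnorm_ge0.
rewrite -(ler_pXn2r (ltn0Sn 1)) ?nnegrE //; last first.
  rewrite mulr_ge0 ?invr_ge0 // sumr_ge0 // => a _; rewrite sumr_ge0 // => b _.
  by rewrite mulr_ge0 // sqr_ge0.
apply: le_trans (_ : trnorm Y ^+ 2 * trnorm (mxbracket (rdiag lam) Y) ^+ 2 <= _).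
  rewrite !sqr_trnorm mulrACA -expr2 exprMn ler_wpM2l ?sqr_ge0 //.
  rewrite !hs_pair pair_bigA /=.
  have -> : \sum_p Normc.normc (mxbracket (rdiag lam) Y p.1 p.2) ^+ 2 =
      \sum_(p : 'I_n * 'I_n) (Normc.normc (Y p.1 p.2) * `|lam p.1 - lam p.2|) ^+ 2.
    apply: eq_bigr => -[a b] _ /=; congr (_ ^+ 2).
    have -> : mxbracket (rdiag lam) Y a b = Y a b * ((lam a - lam b)%:C)%C.
      rewrite mxE [X in _ + X]mxE rdiag_mull rdiag_mulr rmorphB /=.
      by rewrite mulrBr mulrC.
    by rewrite Normc.normcM normc_real.
  apply: le_trans (sum_cauchy_schwarz _ _).
  rewrite le_eqVlt; apply/orP; left; apply/eqP; congr (_ ^+ 2).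
  by apply: eq_bigr => p _; rewrite mulrA -expr2.
rewrite -[leRHS]mul1r ler_pM ?sqr_ge0 //.
  by rewrite exprn_ile1 ?trnorm_ge0.
by rewrite lerXn2r ?nnegrE ?trnorm_ge0.
Qed.

(** One offset must serve all K matrices, so the cells are chosen for the sum of their weights;
    hence the factor K. The factor 2 is one delta / eps from the averaged distances and another from
    the rounding term 1 / M. *)
Lemma block_step_diag (R : realType) (n K : nat) (lam : 'I_n -> R)
    (Y : 'I_K -> 'M[R[i]]_n) (delta eps : R) :
  (0 < n)%N -> 0 < delta -> 0 < eps -> contraction (rdiag lam) ->
  (forall j, contraction (Y j)) ->
  (forall j, Y j = (Y j)^t*) ->
  (forall j, trnorm (mxbracket (rdiag lam) (Y j)) <= delta) ->
  exists (A : 'M[R[i]]_n) (B : 'I_K -> 'M[R[i]]_n),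
    [/\ contraction A, A = A^t*, trnorm (rdiag lam - A) <= eps / 2 &
        forall X, X *m rdiag lam = rdiag lam *m X -> X *m A = A *m X] /\
    forall j, [/\ contraction (B j), B j = (B j)^t*,
        trnorm (Y j - B j) ^+ 2 <= 2 * K%:R * delta / eps,
        B j *m A = A *m B j &
        forall X, X *m rdiag lam = rdiag lam *m X -> X *m Y j = Y j *m X ->
          X *m B j = B j *m X].
Proof.
move=> n0 d0 e0 cl cY aY dY.
have lam1 := rdiag_contraction cl.
(* M exceeds eps / delta, so that the rounding term 1 / M is at most delta / eps. *)
pose M := (Num.truncn (eps / delta)).+1.
have M0 : (0 < M)%N by [].
have hM : M%:R^-1 <= delta / eps.
  rewrite -[leRHS]invrK invf_div lef_pV2 ?posrE ?divr_gt0 ?ltr0n // ltW //.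
  by have /andP[] := truncn_itv (ltW (divr_gt0 e0 d0)).
pose w a b := \sum_j n%:R^-1 * Normc.normc (Y j a b) ^+ 2.
have w0 a b : 0 <= w a b.
  by apply: sumr_ge0 => j _; rewrite mulr_ge0 ?invr_ge0 ?sqr_ge0.
have lam1' a : -1 <= lam a by have := lam1 a; rewrite ler_norml => /andP[].
have [lab [c [labE lam_c wlab]]] := exists_cells M0 e0 lam1' w0.
pose g l := Num.max (-1) (Num.min 1 (c l)).
pose B j := pinch lab (Y j).
have sumB : \sum_j trnorm (Y j - B j) ^+ 2 <= 2 * K%:R * delta / eps.
  apply: le_trans (_ : \sum_a \sum_b w a b *+ (lab a != lab b) <= _).
    rewrite le_eqVlt; apply/orP; left; apply/eqP.
    under eq_bigr do rewrite sqr_trnorm hs_pinch_compl mulr_sumr.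
    rewrite exchange_big; apply: eq_bigr => a _ /=.
    under eq_bigr do rewrite mulr_sumr.
    rewrite exchange_big; apply: eq_bigr => b _ /=.
    by rewrite /w -sumrMnl; apply: eq_bigr => j _; rewrite mulrnAr.
  apply: le_trans wlab _.
  have -> : 2 * K%:R * delta / eps = \sum_(j < K) (delta / eps + delta / eps).
    by rewrite sumr_const card_ord -mulr_natl; ring.
  rewrite /w; under eq_bigr do under eq_bigr do rewrite mulr_suml.
  under eq_bigr do rewrite exchange_big /=.
  rewrite exchange_big; apply: ler_sum => j _ /=.
  have Y1 : trnorm (Y j) <= 1 by exact: trnorm_contraction.
  under eq_bigr do under eq_bigr do rewrite mulrDr.
  under eq_bigr do rewrite big_split /=.
  rewrite big_split /= lerD //.
    rewrite ler_pdivlMr //; apply: le_trans (weighted_dist_le Y1 (dY j)).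
    rewrite mulr_suml mulr_sumr; apply: ler_sum => a _.
    rewrite mulr_suml mulr_sumr; apply: ler_sum => b _.
    by rewrite !mulrA divfK ?lt0r_neq0.
  apply: le_trans (_ : trnorm (Y j) ^+ 2 * M%:R^-1 <= _).
    rewrite sqr_trnorm mulr_sumr mulr_suml; apply: ler_sum => a _.
    by rewrite mulr_sumr mulr_suml.
  apply: le_trans hM; rewrite ler_piMl ?invr_ge0 //.
  by rewrite exprn_ile1 ?trnorm_ge0.
exists (rdiag (g \o lab)), B; split; [split|].
- by apply: contraction_rdiag => a; exact: norm_max_min.
- by rewrite rdiag_adj.
- apply: trnorm_le; first by rewrite ltW // divr_gt0.
  rewrite sqr_trnorm; apply: hs_rdiag => a.
  by apply: le_trans (lam_c a); exact: max_min_dist.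
- by move=> X Xl; apply: pinch_comm_rdiag; exact: rdiag_comm_pinch Xl.
move=> j; split.
- exact: contraction_pinch.
- by rewrite /B pinch_adj -aY.
- apply: le_trans sumB; rewrite (bigD1 j) //= lerDl.
  by apply: sumr_ge0 => k _; exact: sqr_ge0.
- by apply: pinch_comm_rdiag; rewrite pinch_id.
(* X is block diagonal because it commutes with [rdiag lam], so it can be moved through the pinching
   on either side. *)
- move=> X Xl XY; have hX := rdiag_comm_pinch labE Xl.
  by rewrite /B -pinch_mull // XY pinch_mulr.
Qed.

(** * Unitary conjugation and diagonalization *)

Definition uconj (R : realType) (n : nat) (P X : 'M[R[i]]_n) := P *m X *m P^t*.

Lemma uconjM (R : realType) (n : nat) (P X Y : 'M[R[i]]_n) :
  P^t* *m P = 1%:M -> uconj P (X *m Y) = uconj P X *m uconj P Y.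
Proof. by move=> PP; rewrite /uconj !mulmxA -[_ *m P^t* *m P]mulmxA PP mulmx1. Qed.

Lemma uconjB (R : realType) (n : nat) (P X Y : 'M[R[i]]_n) :
  uconj P (X - Y) = uconj P X - uconj P Y.
Proof. by rewrite /uconj mulmxBr mulmxBl. Qed.

Lemma uconj_adj (R : realType) (n : nat) (P X : 'M[R[i]]_n) :
  (uconj P X)^t* = uconj P (X^t*).
Proof. by rewrite /uconj !adjmxM trmxCK mulmxA. Qed.

Lemma uconjK (R : realType) (n : nat) (P X : 'M[R[i]]_n) :
  P^t* *m P = 1%:M -> uconj (P^t*) (uconj P X) = X.
Proof.
by move=> PP; rewrite /uconj trmxCK !mulmxA PP mul1mx -mulmxA PP mulmx1.
Qed.

Lemma hs_uconj (R : realType) (n : nat) (P X : 'M[R[i]]_n) :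
  P^t* *m P = 1%:M -> hs (uconj P X) = hs X.
Proof.
move=> PP; rewrite /uconj -mulmxA hs_isometry // -hs_adj adjmxM trmxCK.
by rewrite hs_isometry // hs_adj.
Qed.

Lemma contraction_uconj (R : realType) (n : nat) (P X : 'M[R[i]]_n) :
  P^t* *m P = 1%:M -> contraction X -> contraction (uconj P X).
Proof.
move=> PP cX v; rewrite /uconj -!mulmxA hs_isometry //.
apply: le_trans (cX _) _; rewrite hs_isometry // trmxCK.
exact: mulmx1C.
Qed.

Lemma hermitian_diagonalization (R : realType) (n : nat) (H : 'M[R[i]]_n) :
  H = H^t* -> exists (P : 'M[R[i]]_n) (lam : 'I_n -> R),
    P^t* *m P = 1%:M /\ uconj P H = rdiag lam.
Proof.
move=> Hh; have hH : H \is hermsymmx.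
  by rewrite is_hermitianmxE expr0 scale1r -Hh.
have uP := spectral_unitarymx H; have PP := unitarymxP uP.
(* The spectrum of a hermitian matrix is real, so taking real parts loses nothing. *)
exists (spectralmx H), (fun a => complex.Re (spectral_diag H 0 a)).
have PP' := mulmx1C PP; split => //.
have /orthomx_spectralP hs := hermitian_normalmx hH.
rewrite /uconj {2}hs invmx_unitary // !mulmxA PP mul1mx -mulmxA PP mulmx1.
rewrite /rdiag; congr diag_mx; apply/rowP => a; rewrite mxE.
by rewrite RRe_real //; exact: (mxOverP (hermitian_spectral_diag_real hH)).
Qed.

(** All norms and relations involved are invariant under unitary conjugation, which reduces to a
    diagonal H. *)
Lemma block_step (R : realType) (n K : nat) (H : 'M[R[i]]_n)
    (Y : 'I_K -> 'M[R[i]]_n) (delta eps : R) :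
  (0 < n)%N -> 0 < delta -> 0 < eps -> contraction H -> H = H^t* ->
  (forall j, contraction (Y j)) ->
  (forall j, Y j = (Y j)^t*) ->
  (forall j, trnorm (mxbracket H (Y j)) <= delta) ->
  exists (A : 'M[R[i]]_n) (B : 'I_K -> 'M[R[i]]_n),
    [/\ contraction A, A = A^t*, trnorm (H - A) <= eps / 2 &
        forall X, X *m H = H *m X -> X *m A = A *m X] /\
    forall j, [/\ contraction (B j), B j = (B j)^t*,
        trnorm (Y j - B j) ^+ 2 <= 2 * K%:R * delta / eps,
        B j *m A = A *m B j &
        forall X, X *m H = H *m X -> X *m Y j = Y j *m X ->
          X *m B j = B j *m X].
Proof.
move=> n0 d0 e0 cH /hermitian_diagonalization[P [lam [PP HE]]] cY aY dY.
have PP' : (P^t*)^t* *m P^t* = 1%:M by rewrite trmxCK; exact: mulmx1C.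
have K1 X : uconj (P^t*) (uconj P X) = X by exact: uconjK.
have K2 X : uconj P (uconj (P^t*) X) = X by rewrite -{1}[P]trmxCK uconjK.
have tP X : trnorm (uconj (P^t*) X) = trnorm X by rewrite !trnorm_hs hs_uconj.
have [||||A [B [[cA aA dA bA] hB]]] :=
  @block_step_diag R n K lam (fun j => uconj P (Y j)) delta eps n0 d0 e0.
- by rewrite -HE; exact: contraction_uconj.
- by move=> j; exact: contraction_uconj.
- by move=> j; rewrite uconj_adj -aY.
- move=> j; rewrite -HE /mxbracket -!uconjM // -uconjB -tP K1; exact: dY.
have com X Z : uconj P X *m Z = Z *m uconj P X <->
    X *m uconj (P^t*) Z = uconj (P^t*) Z *m X.
  rewrite -{3 4}[X]K1 -!uconjM //; split=> [-> //|e].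
  by rewrite -[LHS]K2 e K2.
have comH X : X *m H = H *m X -> uconj P X *m rdiag lam = rdiag lam *m uconj P X.
  by rewrite -HE -!uconjM // => ->.
exists (uconj (P^t*) A), (fun j => uconj (P^t*) (B j)); split; [split|].
- exact: contraction_uconj.
- by rewrite uconj_adj -aA.
- by rewrite -[H]K1 HE -uconjB tP.
- by move=> X /comH /bA /com.
move=> j; have [cB aB eB AB bB] := hB j; split.
- exact: contraction_uconj.
- by rewrite uconj_adj -aB.
- by rewrite -[Y j]K1 -uconjB tP.
- by rewrite -!uconjM // AB.
- by move=> X /comH XH XY; apply/com/bB => //; rewrite -!uconjM // XY.
Qed.

(** * Numerical estimates for the induction *)

(** Lets geometric decay absorb the number of matrices: 1/25 bounds t^2 for t < 1/5, and 81/100 is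
    (9/10)^2. *)
Lemma natr_mul_expr_le (F : realFieldType) (p : nat) :
  p.+1%:R * (1 / 25) ^+ p <= (81 / 100) ^+ p :> F.
Proof.
elim: p => [|p IHp]; first by rewrite !expr0 mulr1.
have h : 0 <= (1 / 25) ^+ p :> F by rewrite exprn_ge0 //; lra.
apply: le_trans (_ : 81 / 100 * (p.+1%:R * (1 / 25) ^+ p) <= _).
  have h' : 0 <= p%:R * (1 / 25) ^+ p :> F by rewrite mulr_ge0.
  rewrite -[p.+2%:R]natr1 -natr1 exprS; nra.
by rewrite exprS ler_wpM2l //; lra.
Qed.

(** The left side is the bound of [block_step] for delta = t^(4N) and eps = 10 t. The constants fit
    since t / 5 <= 1/25 <= (6/25)^2 (9/10)^2. *)
Lemma pinching_error_le (F : realFieldType) (K N : nat) (t : F) :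
  0 < t -> t < 1 / 5 -> (0 < N)%N -> (K <= N)%N ->
  2 * K%:R * t ^+ (4 * N) / (10 * t) <= (6 / 25 * (9 / 10 * t) ^+ N) ^+ 2.
Proof.
move=> t0 t5; case: N => // p _ Kp.
have -> : 2 * K%:R * t ^+ (4 * p.+1) / (10 * t) =
    1 / 5 * K%:R * t * (t ^+ 2) ^+ p * (t ^+ p.+1) ^+ 2.
  have -> : t ^+ (4 * p.+1) = t ^+ 2 * (t ^+ 2) ^+ p * (t ^+ p.+1) ^+ 2.
    by rewrite -exprS -!exprM -exprD; congr (t ^+ _); lia.
  by field; rewrite lt0r_neq0.
have -> : (6 / 25 * (9 / 10 * t) ^+ p.+1) ^+ 2 =
    (36 / 625 * (81 / 100) * (81 / 100) ^+ p) * (t ^+ p.+1) ^+ 2.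
  have -> : 81 / 100 = (9 / 10) ^+ 2 :> F by field.
  rewrite [(9 / 10 * t) ^+ _]exprMn [(9/10) ^+ p.+1]exprS -exprM mulnC exprM.
  by field.
rewrite ler_wpM2r ?sqr_ge0 //.
apply: le_trans (_ : 1 / 25 * (p.+1%:R * (1 / 25) ^+ p) <= _); last first.
  have h : 0 <= (81 / 100) ^+ p :> F by rewrite exprn_ge0 //; lra.
  have := natr_mul_expr_le F p; nra.
rewrite mulrA; apply: ler_pM.
- by rewrite mulr_ge0 ?(ltW t0) // mulr_ge0 //; lra.
- by rewrite exprn_ge0 ?sqr_ge0.
- have : K%:R <= p.+1%:R :> F by rewrite ler_nat.
  have : 0 <= K%:R :> F by []. nra.
- by rewrite lerXn2r ?nnegrE ?sqr_ge0 //; nra.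
Qed.

(** The spare factor t^(3N) is below (9/10)^N / 25 because t^3 <= 1/125. *)
Lemma expr_4N_le (F : realFieldType) (N : nat) (t : F) :
  0 < t -> t < 1 / 5 -> (0 < N)%N ->
  t ^+ (4 * N) <= 1 / 25 * (9 / 10 * t) ^+ N.
Proof.
move=> t0 t5; case: N => // p _.
have -> : t ^+ (4 * p.+1) = (t ^+ 3) ^+ p.+1 * t ^+ p.+1.
  by rewrite -exprM -exprD; congr (t ^+ _); lia.
rewrite [(9 / 10 * t) ^+ _]exprMn mulrA ler_wpM2r ?exprn_ge0 ?(ltW t0) //.
have t3 : t ^+ 3 <= (1 / 5) ^+ 3.
  by rewrite lerXn2r ?nnegrE ?(ltW t0) ?(ltW t5) //; lra.
have t30 : 0 <= t ^+ 3 by rewrite exprn_ge0 // ltW.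
rewrite [(t ^+ 3) ^+ _]exprS [(9 / 10) ^+ _]exprS mulrA.
apply: ler_pM => //.
- by rewrite exprn_ge0.
- by apply: le_trans t3 _; lra.
- by rewrite lerXn2r ?nnegrE //; lra.
Qed.

(** * Perturbation of commutators and the induction *)

Lemma trnorm_eq0 (R : realType) (n : nat) (A : 'M[R[i]]_n) :
  (0 < n)%N -> trnorm A <= 0 -> A = 0.
Proof.
move=> n0 A0; apply: hs_eq0; apply/eqP.
have : trnorm A ^+ 2 == 0 by rewrite sqrf_eq0 eq_le A0 trnorm_ge0.
by rewrite sqr_trnorm mulf_eq0 invr_eq0 pnatr_eq0 -leqn0 leqNgt n0.
Qed.

Lemma trnorm_mxbracket_le (R : realType) (n : nat) (A B : 'M[R[i]]_n) :
  contraction A -> A = A^t* -> trnorm (mxbracket A B) <= 2 * trnorm B.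
Proof.
move=> cA aA; apply: le_trans (trnormD _ _) _; rewrite trnormN.
have cA' : contraction (A^t*) by rewrite -aA.
have := le_trnorm (hs_contractionl B cA).
have := le_trnorm (hs_contractionr B cA').
lra.
Qed.

(** By [B1, B2] = [Y1, Y2] + [Y2, Y1 - B1] - [B1, Y2 - B2], each correction pairs an error with a
    selfadjoint contraction and costs 2 e. *)
Lemma trnorm_mxbracket_perturb (R : realType) (n : nat)
    (Y1 Y2 B1 B2 : 'M[R[i]]_n) (d e : R) :
  contraction B1 -> B1 = B1^t* -> contraction Y2 -> Y2 = Y2^t* ->
  trnorm (mxbracket Y1 Y2) <= d ->
  trnorm (Y1 - B1) <= e -> trnorm (Y2 - B2) <= e ->
  trnorm (mxbracket B1 B2) <= d + 4 * e.
Proof.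
move=> cB aB cY aY hY h1 h2.
have -> : mxbracket B1 B2 = mxbracket Y1 Y2 +
    (mxbracket Y2 (Y1 - B1) + - mxbracket B1 (Y2 - B2)).
  rewrite /mxbracket !mulmxBr !mulmxBl.
  by apply/matrixP => a b; rewrite !mxE; ring.
have := trnormD (mxbracket Y1 Y2)
  (mxbracket Y2 (Y1 - B1) + - mxbracket B1 (Y2 - B2)).
have := trnormD (mxbracket Y2 (Y1 - B1)) (- mxbracket B1 (Y2 - B2)).
have := trnorm_mxbracket_le (Y1 - B1) cY aY.
have := trnorm_mxbracket_le (Y2 - B2) cB aB.
rewrite trnormN; lra.
Qed.

(* The bicommutant clause lets the induction run on full matrices instead of on
   the blocks of the first matrix: applied to X = A_1 it makes the matrices found
   in the next step commute with A_1. *)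
Lemma commuting_approximation (R : realType) (n k : nat)
    (H : 'I_k.+1 -> 'M[R[i]]_n) (t : R) :
  (0 < n)%N -> 0 <= t ->
  (forall j, contraction (H j)) -> (forall j, H j = (H j)^t*) ->
  (forall i j, trnorm (mxbracket (H i) (H j)) <= t ^+ (4 ^ k)) ->
  exists A : 'I_k.+1 -> 'M[R[i]]_n,
    [/\ forall j, [/\ contraction (A j), A j = (A j)^t* &
                      trnorm (H j - A j) <= 5 * t],
        forall X, (forall j, X *m H j = H j *m X) ->
          forall j, X *m A j = A j *m X,
        forall i j, A i *m A j = A j *m A i &
        H ord0 *m A ord0 = A ord0 *m H ord0].
Proof.
move=> n0 + + + +; have tr0 : trnorm (0 : 'M[R[i]]_n) = 0.
  by rewrite trnorm_hs hs0 mulr0 sqrtr0.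
(* Exactly commuting matrices approximate themselves. This settles k = 0 and also t = 0, where
   [block_step] does not apply. *)
have commuting (m : nat) (G : 'I_m.+1 -> 'M[R[i]]_n) (s : R) : 0 <= s ->
    (forall j, contraction (G j)) -> (forall j, G j = (G j)^t*) ->
    (forall i j, G i *m G j = G j *m G i) ->
  exists A : 'I_m.+1 -> 'M[R[i]]_n,
    [/\ forall j, [/\ contraction (A j), A j = (A j)^t* &
                      trnorm (G j - A j) <= 5 * s],
        forall X, (forall j, X *m G j = G j *m X) ->
          forall j, X *m A j = A j *m X,
        forall i j, A i *m A j = A j *m A i &
        G ord0 *m A ord0 = A ord0 *m G ord0].
  move=> s0 cG aG comG; exists G; split=> // j; split=> //.
  by rewrite subrr tr0 mulr_ge0.
elim: k H t => [|k IHk] H t t0 cH aH dH.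
  by apply: commuting => // i j; rewrite !ord1.
have [t5|t5] := leP (1 / 5) t.
  exists (fun=> 0); split=> [j|X _ j|i j|]; rewrite ?mulmx0 ?mul0mx //.
  split; first by move=> v; rewrite mul0mx hs0 hs_ge0.
    by rewrite trmx0 map_mx0.
  by rewrite subr0; apply: le_trans (trnorm_contraction n0 (cH j)) _; lra.
have [tz|tn0] := eqVneq t 0.
  apply: commuting => // i j; apply/eqP; rewrite -subr_eq0; apply/eqP.
  apply: trnorm_eq0 => //; apply: le_trans (dH i j) _.
  by rewrite tz expr0n expn_eq0.
have tp : 0 < t by rewrite lt_def tn0.
pose N := (4 ^ k)%N; have N0 : (0 < N)%N by rewrite expn_gt0.
have kN : (k.+1 <= N)%N by exact: ltn_expl.
pose Y j := H (lift ord0 j).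
(* With the 1/25 of [expr_4N_le], the constant 6/25 gives 1/25 + 4 (6/25) = 1, so the new
   commutators are bounded by (9 t / 10)^N. *)
pose eta := 6 / 25 * (9 / 10 * t) ^+ N.
have tN0 : 0 <= (9 / 10 * t) ^+ N by rewrite exprn_ge0 //; lra.
have eta0 : 0 <= eta by rewrite mulr_ge0 //; lra.
(* Here 4^(k+1) = 4 N, and eps / 2 = 5 t is the error allowed for [A0]. *)
have [|||||||A0 [B [[cA aA eA bA] hB]]] :=
  @block_step R n k.+1 (H ord0) Y (t ^+ (4 * N)) (10 * t) n0.
- by rewrite exprn_gt0.
- by lra.
- exact: cH.
- exact: aH.
- by move=> j; exact: cH.
- by move=> j; exact: aH.
- by move=> j; rewrite -expnS; exact: dH.
have etaB j : trnorm (Y j - B j) <= eta.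
  apply: trnorm_le => //; have [_ _ eB _ _] := hB j.
  by apply: le_trans eB _; exact: pinching_error_le.
have [||||A' [hA' bA' comA' _]] := IHk B (9 / 10 * t).
- by lra.
- by move=> j; have [] := hB j.
- by move=> j; have [] := hB j.
- move=> i j; have [cB aB _ _ _] := hB i.
  have := trnorm_mxbracket_perturb cB aB (cH (lift ord0 j)) (aH (lift ord0 j))
    (dH (lift ord0 i) (lift ord0 j)) (etaB i) (etaB j).
  move=> h; apply: le_trans h _; rewrite expnS.
  have := expr_4N_le tp t5 N0; rewrite -/N /eta; lra.
pose A j := if unlift ord0 j is Some i then A' i else A0.
have A_lift j : A (lift ord0 j) = A' j by rewrite /A liftK.
have A_0 : A ord0 = A0 by rewrite /A unlift_none.
have ordP (P : 'I_k.+2 -> Prop) : P ord0 -> (forall j, P (lift ord0 j)) ->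
    forall j, P j.
  by move=> P0 P1 j; have [i ->|->] := unliftP ord0 j.
have comA0 j : A0 *m A' j = A' j *m A0.
  by apply: bA' => i; have [_ _ _ -> _] := hB i.
exists A; split.
- apply: ordP => [|j]; rewrite ?A_0 ?A_lift.
    by split=> //; apply: le_trans eA _; lra.
  have [cA' aA' eA'] := hA' j; split=> //.
  have -> : H (lift ord0 j) - A' j = (Y j - B j) + (B j - A' j).
    by rewrite addrA subrK.
  apply: le_trans (trnormD _ _) _.
  (* The total error is at most (6/25) (9 t / 10) + 5 (9 t / 10) = 4.716 t. *)
  have : (9 / 10 * t) ^+ N <= 9 / 10 * t.
    by rewrite -[leRHS]expr1 ler_wiXn2l //; lra.
  have := etaB j; rewrite /eta; lra.
- move=> X XH; apply: ordP => [|j]; rewrite ?A_0 ?A_lift; first exact: bA.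
  by apply: bA' => i; have [_ _ _ _] := hB i; apply; exact: XH.
- move=> i j; have [i' ->|->] := unliftP ord0 i;
    by have [j' ->|->] := unliftP ord0 j; rewrite ?A_0 ?A_lift.
- by rewrite A_0; exact: bA.
Qed.

(** * From t back to delta *)

Theorem theorem3 (R : realType) (n m : nat) (hn : (1 <= n)%N) (hm : (3 <= m)%N)
    (H : 'I_m -> 'M[R[i]]_n)
    (H_adj : forall j : 'I_m, H j = (H j)^t*)
    (H_norm : forall j : 'I_m, opnorm (H j) <= 1)
    (delta : R) (delta_ge0 : 0 <= delta)
    (H_comm : forall i j : 'I_m, trnorm (mxbracket (H i) (H j)) <= delta)
    (delta_small : delta <= 1 / 16 ^+ (2 * 4 ^ (m - 2))) :
  exists A : 'I_m -> 'M[R[i]]_n,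
    [/\ forall j : 'I_m,
          [/\ opnorm (A j) <= 1,
              A j = (A j)^t* &
              trnorm (H j - A j) <= 5 * delta `^ (1 / 4 ^+ (m - 1))],
        forall i j : 'I_m, mxbracket (A i) (A j) = 0 &
        forall j : 'I_m, j = 0%N :> nat -> mxbracket (H j) (A j) = 0].
Proof.
case: m hm H H_adj H_norm H_comm {delta_small} => // k _ H H_adj H_norm H_comm.
(* With m = k + 1 the exponent is 1 / 4^k, so delta = t^(4^k), the commutator bound of
   [commuting_approximation]. *)
rewrite subn1 /=; set t := delta `^ _.
have tE : t ^+ (4 ^ k) = delta.
  rewrite -powR_mulrn ?powR_ge0 // -powRrM natrX mul1r mulVf ?powRr1 //.
have [|j|||A [hA _ comA com0]] := @commuting_approximation R n k H t hn => //.
- exact: powR_ge0.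
- exact: opnorm_contraction.
- by rewrite tE.
exists A; split=> [j|i j|j j0].
- by have [cA aA eA] := hA j; split=> //; exact: contraction_opnorm.
- by rewrite /mxbracket comA subrr.
- by have -> : j = ord0 by [apply/val_inj]; rewrite /mxbracket com0 subrr.
Qed.
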